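(* For $d\ge2$, let $\alpha_c'(d)$ be the critical threshold for the parking process on the infinite $d$-ary tree $\mathbb T_d$ with $\eta(\alpha)=3$ with probability $\alpha/3$ and $\eta(\alpha)=0$ otherwise, and let $\alpha_c(d)$ be the critical threshold for the parking process on $\mathbb T_d$ with $\eta(\alpha)=2$ with probability $\alpha/2$ and $\eta(\alpha)=0$ otherwise. It holds that $$\alpha_c'(d)\le 3d^{-3}.$$ Consequently, $\alpha_c'(d)<\alpha_c(d)$ for all large enough $d$.
   Context: Parking process: on a tree with root $\rho$, each vertex has one parking spot. Initially (time $0$) $\eta_v$ cars arrive to each vertex $v$. Cars move towards the root in discrete time, one edge per time step. When a car arrives at an available spot it parks there and the spot becomes unavailable; if several cars arrive at the same available spot simultaneously, one chosen uniformly at random parks there and the others continue towards the root. (This applies also to the cars arriving initially at a vertex.) $X\in\{0,1,\dots\}\cup\{\infty\}$ is the total number of cars that ever arrive to $\rho$, including the $\eta_\rho$ cars initially there. The $\eta_v$ are i.i.d. with law $\eta(\alpha)$, where $E\eta(\alpha)=\alpha$. $\mathbb T_d$ is the infinite rooted tree in which each vertex has $d$ children. For each of the two families $(\eta(\alpha))$ in the claim (with $\alpha\in[0,3]$ and $\alpha\in[0,2]$ respectively), the critical threshold is the number in $(0,1)$ such that $EX<\infty$ for $\alpha$ below it and $X=\infty$ almost surely for $\alpha$ above it (its existence is a theorem of Goldschmidt and Przykucki). *)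

(* Defs.v *)
From mathcomp Require Export all_boot all_order all_algebra.
From mathcomp Require Export all_classical all_reals all_analysis.

Set Implicit Arguments.
Unset Strict Implicit.
Unset Printing Implicit Defensive.

Export Order.TTheory GRing.Theory Num.Theory.
Export numFieldNormedType.Exports.

Local Open Scope classical_set_scope.
Local Open Scope ring_scope.

(* Vertices of the infinite d-ary tree as words: the root is [::], the children
   of v are the words i :: v, and the parent of i :: v is v. *)
Definition vertex (d : nat) : eqType := seq 'I_d.

Definition root_vertex (d : nat) : vertex d := [::].

(* The car (v, j) is the j-th of the cars that start at v. *)
Definition car (d : nat) : Type := (vertex d * nat)%type.

Section Dynamics.
Variable d : nat.

(* eta v is the number of cars starting at v. choice v k settles the competition
   if exactly k.+1 cars reach the available spot of v simultaneously: the car at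
   position choice v k in the list of these cars parks. At most one competition
   takes place at each vertex, so at most one choice v k is used for each v. *)
Variables (eta : vertex d -> nat) (choice : vertex d -> forall k, 'I_k.+1).

Definition park_one (v : vertex d) (s : seq (car d)) : seq (car d) :=
  let k : nat := choice v (size s).-1 in take k s ++ drop k.+1 s.

(* At time t: the availability of the spot of each vertex just before the
   arrivals of time t, and the cars arriving to each vertex at time t. *)
Fixpoint parking_state (t : nat) :
    (vertex d -> bool) * (vertex d -> seq (car d)) :=
  if t is t'.+1 then
    let: (available, arrivals) := parking_state t' in
    let continuing v :=
      if available v then park_one v (arrivals v) else arrivals v in
    (fun v => available v && nilp (arrivals v),
     fun v => flatten [seq continuing (i :: v) | i <- enum 'I_d])
  else (fun=> true, fun v => [seq (v, j) | j <- iota 0 (eta v)]).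

Definition arrivals_at (t : nat) (v : vertex d) : seq (car d) :=
  (parking_state t).2 v.

(* No car visits a vertex twice, so summing the arrivals to the root over all
   times counts every car arriving there once. *)
Definition total_arrivals (R : realType) : \bar R :=
  (\sum_(0 <= t <oo) (size (arrivals_at t (root_vertex d)))%:R%:E)%E.

End Dynamics.

Section Independence.
Context (disp : measure_display) (Omega : measurableType disp) (R : realType).

(* Events determined by a random variable with values in a discrete space. *)
Definition events_of (E : Type) (f : Omega -> E) : set (set Omega) :=
  [set A | exists B : set E, A = f @^-1` B].

Definition mutually_independent (P : probability Omega R) (I : eqType)
    (F : I -> set (set Omega)) : Prop :=
  (forall i, F i `<=` measurable) /\
  forall (s : seq I) (A : I -> set Omega), uniq s ->
    (forall i, i \in s -> F i (A i)) ->
    P (\bigcap_(i in [set` s]) A i) = (\prod_(i <- s) P (A i))%E.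

End Independence.

(* A probability space carrying the randomness of the parking process on the
   d-ary tree, where law n is the probability that n cars start at a vertex. *)
Record parking_model (R : realType) (d : nat) (law : nat -> R) := ParkingModel {
  pm_disp : measure_display;
  pm_space : measurableType pm_disp;
  pm_prob : probability pm_space R;
  pm_eta : vertex d -> pm_space -> nat;
  pm_choice : vertex d -> forall k, pm_space -> 'I_k.+1;
  pm_independent : mutually_independent pm_prob
    (fun a : vertex d + vertex d * nat =>
       match a with
       | inl v => events_of (pm_eta v)
       | inr (v, k) => events_of (@pm_choice v k)
       end);
  pm_eta_law : forall v n, pm_prob (pm_eta v @^-1` [set n]) = (law n)%:E;
  pm_choice_law : forall v k (i : 'I_k.+1),
    pm_prob (@pm_choice v k @^-1` [set i]) = (k.+1%:R^-1)%:E
}.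

Arguments pm_eta {R d law} M v w : rename.
Arguments pm_choice {R d law} M v k w : rename.

Definition root_total (R : realType) (d : nat) (law : nat -> R)
    (M : parking_model d law) (w : pm_space M) : \bar R :=
  total_arrivals (fun v => pm_eta M v w) (fun v k => pm_choice M v k w) R.

(* m cars with probability alpha / m, none otherwise; the mean is alpha. *)
Definition group_law (R : realType) (m : nat) (alpha : R) (n : nat) : R :=
  if n == m then alpha / m%:R else if n == 0%N then 1 - alpha / m%:R else 0.

(* The law of root_total is the same in all models with the same parameters, so
   the property below does not depend on the chosen realizations M. *)
Definition is_critical_threshold (R : realType) (d m : nat)
    (M : forall alpha : R, 0 <= alpha <= m%:R ->
         parking_model d (group_law m alpha)) (alpha_c : R) : Prop :=
  0 < alpha_c < 1 /\
  forall (alpha : R) (h : 0 <= alpha <= m%:R),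
    (alpha < alpha_c ->
       (\int[pm_prob (M alpha h)]_w root_total w < +oo)%E) /\
    (alpha_c < alpha ->
       {ae pm_prob (M alpha h), forall w, root_total w = +oo%E}).

(* Main.v *)
(* Let S_t(v) be the number of cars that reach v before time t. Whatever the
   outcomes of the competitions, S_(t+1)(v) = eta_v + sum_c (S_t(c) - 1)^+ over
   the children c of v, so only the independent family (eta_v) matters.

   Upper bound, at alpha = 3 d^-3, where triples have probability p = d^-3: a
   triple compensates exactly for its own spot and the next two spots towards
   the root. Hence in the Galton-Watson tree of the triples reached from the
   root by jumps of three generations (mean offspring d^3 p = 1), each time two
   such jumps share their last two spots at least one additional car reaches
   the root.
   Every generation contributes the same positive expected number of such
   overlaps, so EX is infinite.

   Lower bound, at alpha = 4 d^-3 > 3 d^-3, where pairs have probability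
   p = 2 d^-3: put z = 4d and f_t = E z^(S_t). From
   z^((S-1)^+) <= 1 + (z^S - 1)/z one gets
   f_(t+1) <= (1 + (z^2 - 1) p) (1 + (f_t - 1)/z)^d, and this recursion stays
   below 2 for d >= 64, so X is not almost surely infinite.

   Both bounds compare S_t pointwise with a polynomial in the indicators of
   the groups in which every vertex occurs at most once per monomial; its
   expectation is obtained by substituting p for the indicators. *)
Require Import Defs.
From mathcomp Require Import measurable_realfun zify ring lra.

Set Implicit Arguments.
Unset Strict Implicit.
Unset Printing Implicit Defensive.

Local Open Scope classical_set_scope.
Local Open Scope ring_scope.

(** * The recursion for the number of arrivals *)

Section Counting.
Variables (d : nat) (eta : vertex d -> nat) (choice : vertex d -> forall k, 'I_k.+1).

Definition arrivals_before (t : nat) (v : vertex d) : nat :=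
  \sum_(s < t) size (arrivals_at eta choice s v).

Lemma size_park_one v s : size (park_one choice v s) = (size s).-1.
Proof.
rewrite /park_one size_cat size_take size_drop.
by case: s => [|c s] //=; case: (choice v _) => k /= klt; case: ltnP; lia.
Qed.

Lemma available_arrivals_before t v :
  (parking_state eta choice t).1 v = (arrivals_before t v == 0)%N.
Proof.
elim: t => [|t IH]; first by rewrite /arrivals_before big_ord0.
rewrite /arrivals_before big_ord_recr -/(arrivals_before t v) addn_eq0 -IH /=.
by rewrite /arrivals_at; case: (parking_state eta choice t).
Qed.

(** The first cars to reach a child lose exactly one of their number to its spot, so
    [(arrivals_before t (i :: v)).-1] of those arriving before time [t] move on; truncation at zero
    covers the case of no arrivals. The outcomes of the competitions drop out here. *)
Lemma size_arrivals_atS t v :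
  size (arrivals_at eta choice t.+1 v) =
  (\sum_(i < d) ((arrivals_before t.+1 (i :: v)).-1
                 - (arrivals_before t (i :: v)).-1))%N.
Proof.
transitivity (\sum_(i < d) size (if (parking_state eta choice t).1 (i :: v)
    then park_one choice (i :: v) (arrivals_at eta choice t (i :: v))
    else arrivals_at eta choice t (i :: v)))%N.
  rewrite /arrivals_at /=; case: (parking_state eta choice t) => av ar /=.
  by rewrite size_flatten /shape -map_comp sumnE big_map big_enum.
apply: eq_bigr => i _; rewrite available_arrivals_before.
rewrite [arrivals_before t.+1 _]big_ord_recr -/(arrivals_before t _) /=.
by case: eqP => [->|]; rewrite ?size_park_one; lia.
Qed.

Lemma arrivals_beforeS t v :
  arrivals_before t.+1 v =
  (eta v + \sum_(i < d) (arrivals_before t (i :: v)).-1)%N.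
Proof.
elim: t => [|t IH].
  rewrite /arrivals_before big_ord1 /arrivals_at /= size_map size_iota.
  by rewrite big1 ?addn0 // => i _; rewrite big_ord0.
rewrite /arrivals_before big_ord_recr -/(arrivals_before _ v) IH /=.
rewrite size_arrivals_atS -addnA -big_split; congr addn.
apply: eq_bigr => i _ /=.
rewrite subnKC // [arrivals_before t.+1 _]big_ord_recr -/(arrivals_before t _) /=.
lia.
Qed.

End Counting.

(** * Multilinear polynomials in the group indicators *)

Section Multilinear.
Variables (R : comNzRingType) (V : eqType) (p : R).

(* F is a polynomial whose monomials are products of distinct variables x u with
   D u, and e is its value when every variable is replaced by p. *)
Definition multilinear_mean (D : pred V) (F : (V -> bool) -> R) (e : R) :=
  exists L : seq (R * seq V),
  [/\ all (fun m => uniq m.2 && all D m.2) L,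
      forall x, F x = \sum_(m <- L) m.1 * (all x m.2)%:R
    & e = \sum_(m <- L) m.1 * p ^+ size m.2].

Lemma multilinear_mean_ext D F F' e e' :
  F =1 F' -> e = e' -> multilinear_mean D F e -> multilinear_mean D F' e'.
Proof.
by move=> FF' <- [L [LD LF Le]]; exists L; split=> // x; rewrite -FF'.
Qed.

Lemma multilinear_mean_sub (D D' : pred V) F e :
  {subset D <= D'} -> multilinear_mean D F e -> multilinear_mean D' F e.
Proof.
move=> DD' [L [/allP LD LF Le]]; exists L; split=> //; apply/allP => m mL.
have /andP[-> /allP mD] := LD _ mL.
by apply/allP => u /mD; apply: DD'.
Qed.

Lemma multilinear_mean_cst D c : multilinear_mean D (fun=> c) c.
Proof.
by exists [:: (c, [::])]; split=> // [x|]; rewrite big_seq1 mulr1.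
Qed.

Lemma multilinear_mean_var (D : pred V) v :
  D v -> multilinear_mean D (fun x => (x v)%:R) p.
Proof.
move=> Dv; exists [:: (1, [:: v])].
by split=> [|x|]; rewrite ?big_seq1 /= ?Dv ?andbT ?mul1r.
Qed.

Lemma multilinear_meanD D F e F' e' :
  multilinear_mean D F e -> multilinear_mean D F' e' ->
  multilinear_mean D (fun x => F x + F' x) (e + e').
Proof.
move=> [L [LD LF ->]] [L' [LD' LF' ->]]; exists (L ++ L').
by split=> [|x|]; rewrite ?all_cat ?LD ?LD' ?big_cat /= ?LF ?LF'.
Qed.

(** Disjoint sets of variables keep the concatenated monomials free of repetitions; this is the
    algebraic form of independence. *)
Lemma multilinear_meanM (D D' : pred V) F e F' e' :
  (forall u, D u -> D' u -> False) ->
  multilinear_mean D F e -> multilinear_mean D' F' e' ->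
  multilinear_mean (predU D D') (fun x => F x * F' x) (e * e').
Proof.
move=> DD' [L [/allP LD LF ->]] [L' [/allP LD' LF' ->]].
exists [seq (m.1 * m'.1, m.2 ++ m'.2) | m <- L, m' <- L']; split => [|x|].
- apply/allP => _ /allpairsP[[m m'] [/LD/andP[um mD] /LD'/andP[um' mD'] ->]] /=.
  rewrite cat_uniq um um' all_cat andbT /=; apply/and3P; split.
  + apply/hasPn => u um'2; apply/negP => um2.
    exact: (DD' u (allP mD _ um2) (allP mD' _ um'2)).
  + by apply: sub_all mD => u Du; apply/orP; left.
  + by apply: sub_all mD' => u Du; apply/orP; right.
- rewrite LF LF' big_distrlr big_allpairs_dep /=.
  apply: eq_bigr => m _; apply: eq_bigr => m' _.
  by rewrite all_cat -mulnb natrM mulrACA.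
- rewrite big_distrlr big_allpairs_dep /=.
  apply: eq_bigr => m _; apply: eq_bigr => m' _.
  by rewrite size_cat exprD mulrACA.
Qed.

Lemma multilinear_meanZ D c F e :
  multilinear_mean D F e -> multilinear_mean D (fun x => c * F x) (c * e).
Proof.
move=> FD; have := multilinear_meanM (D := pred0) _ (multilinear_mean_cst _ c) FD.
by move=> /(_ (fun u f _ => notF f)); apply: multilinear_mean_sub.
Qed.

Lemma multilinear_mean_sum (I : Type) (r : seq I) D (F : I -> (V -> bool) -> R) e :
  (forall i, multilinear_mean D (F i) (e i)) ->
  multilinear_mean D (fun x => \sum_(i <- r) F i x) (\sum_(i <- r) e i).
Proof.
move=> FD; elim: r => [|i r IH].
  by apply: (multilinear_mean_ext _ _ (multilinear_mean_cst D 0)) => [x|];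
     rewrite big_nil.
by apply: (multilinear_mean_ext _ _ (multilinear_meanD (FD i) IH)) => [x|];
   rewrite big_cons.
Qed.

Lemma multilinear_mean_prod (I : eqType) (r : seq I) (D : I -> pred V)
    (F : I -> (V -> bool) -> R) e :
  uniq r -> (forall i j u, D i u -> D j u -> i = j) ->
  (forall i, multilinear_mean (D i) (F i) (e i)) ->
  multilinear_mean (fun u => has (D^~ u) r)
    (fun x => \prod_(i <- r) F i x) (\prod_(i <- r) e i).
Proof.
move=> ur DD FD; elim: r ur => [_|i r IH /= /andP[ir ur]].
  by apply: (multilinear_mean_ext _ _ (multilinear_mean_cst _ 1)) => [x|];
     rewrite big_nil.
have DDr u : D i u -> has (D^~ u) r -> False.
  by move=> Du /hasP[j jr /(DD _ _ _ Du) ij]; rewrite ij jr in ir.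
by apply: (multilinear_mean_ext _ _ (multilinear_meanM DDr (FD i) (IH ur)))
  => [x|]; rewrite big_cons.
Qed.

End Multilinear.

(* Unlike in ge0_le_integral, f and g need not be measurable: the integral of a
   nonnegative function is a supremum over the simple functions below it. *)
Lemma ge0_le_integral_nonmeasurable (disp : measure_display)
    (T : measurableType disp) (R : realType)
    (mu : {measure set T -> \bar R}) (f g : T -> \bar R) :
  (forall x, 0 <= f x)%E -> (forall x, f x <= g x)%E ->
  (\int[mu]_x f x <= \int[mu]_x g x)%E.
Proof.
move=> f0 fg; rewrite !ge0_integralTE //; last first.
  by move=> x; apply: le_trans (fg x).
apply: ge_ereal_sup => _ [h /= hf <-]; apply: ereal_sup_ubound.
by exists h => //= x; apply: le_trans (fg x).
Qed.

(** * Expectations over the random groups *)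

Section Model.
Context (R : realType) (d m : nat) (alpha : R).
Variable M : parking_model d (group_law m alpha).

Definition group_at (w : pm_space M) (v : vertex d) : bool := pm_eta M v w == m.

Lemma measurable_pm_eta v (B : set nat) : measurable (pm_eta M v @^-1` B).
Proof. by have [+ _] := pm_independent M; move/(_ (inl v)); apply; exists B. Qed.

Lemma measurable_group_at (s : seq (vertex d)) :
  measurable [set w | all (group_at w) s].
Proof.
elim: s => [|v s IH]; first by rewrite [X in measurable X](_ : _ = setT) // -subTset.
rewrite [X in measurable X](_ : _ =
  (pm_eta M v @^-1` [set m]) `&` [set w | all (group_at w) s]).
  by apply: measurableI => //; apply: measurable_pm_eta.
by apply/seteqP; split=> w /=; [case/andP=> /eqP|case=> /eqP ? ?; apply/andP].
Qed.

Lemma prob_group_at (s : seq (vertex d)) : uniq s ->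
  pm_prob M [set w | all (group_at w) s] = ((alpha / m%:R) ^+ size s)%:E.
Proof.
move=> us; have [_] := pm_independent M.
(* Only [inl] indices occur below; [setT] is a filler for the others. *)
pose A (a : vertex d + vertex d * nat) : set (pm_space M) :=
  if a is inl v then pm_eta M v @^-1` [set m] else setT.
move=> /(_ [seq inl v | v <- s] A).
rewrite map_inj_uniq => [/(_ us) H|v v' []//].
have -> : [set w | all (group_at w) s] =
    \bigcap_(a in [set` [seq inl v | v <- s]]) A a.
  apply/seteqP; split=> w /=.
    by move=> /allP ws _ /mapP[v vs ->] /=; apply/eqP/ws.
  move=> ws; apply/allP => v vs; apply/eqP.
  by apply: (ws (inl v)); apply/mapP; exists v.
rewrite H; last by move=> _ /mapP[v _ ->]; exists [set m].
rewrite big_map; elim: s {us H} => [|v s IH]; first by rewrite big_nil.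
by rewrite big_cons IH exprS (pm_eta_law M) /group_law eqxx.
Qed.

(** A monomial is the indicator that all its vertices carry a group. These vertices are distinct, so
    independence gives the probability, and linearity does the rest. *)
Lemma integral_multilinear_mean D F e :
  multilinear_mean (alpha / m%:R) D F e ->
  (pm_prob M).-integrable setT (fun w => (F (group_at w))%:E) /\
  (\int[pm_prob M]_w (F (group_at w))%:E = e%:E)%E.
Proof.
move=> [L [/allP LD LF ->]].
have FE : (fun w => (F (group_at w))%:E) = (fun w =>
    \sum_(c <- L) c.1%:E * (\1_[set w | all (group_at w) c.2] w)%:E)%E.
  apply/funext => w; rewrite LF -sumEFin; apply: eq_bigr => c _.
  by rewrite indicE mem_setE.
have intL (c : R * seq (vertex d)) : (pm_prob M).-integrable setT
    (fun w => c.1%:E * (\1_[set w | all (group_at w) c.2] w)%:E)%E.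
  apply: integrableZl => //; apply: integrable_indic => //.
  exact: measurable_group_at.
split; rewrite FE; first exact: integrable_sum.
rewrite integral_sum // -sumEFin big_seq [RHS]big_seq.
apply: eq_bigr => c /LD /andP[uc _].
rewrite integralZl //; last by apply: integrable_indic => //; exact: measurable_group_at.
rewrite integral_indic //; last exact: measurable_group_at.
by rewrite setIT EFinM; congr mule; exact: prob_group_at.
Qed.

Lemma ae_pm_eta : (0 < m)%N ->
  {ae pm_prob M, forall w, forall v, pm_eta M v w = (group_at w v * m)%N}.
Proof.
move=> m0.
have H (v : vertex d) : {ae pm_prob M, forall w, pm_eta M v w = (group_at w v * m)%N}.
  exists (~` (pm_eta M v @^-1` [set m] `|` pm_eta M v @^-1` [set 0%N])); split.
  - by apply: measurableC; apply: measurableU; apply: measurable_pm_eta.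
  - rewrite probability_setC; last by apply: measurableU; apply: measurable_pm_eta.
    have -> : pm_prob M (pm_eta M v @^-1` [set m] `|`
                         pm_eta M v @^-1` [set 0%N]) = 1%E; last by rewrite subee.
    etransitivity.
      apply: measureU; try exact: measurable_pm_eta.
      by apply/seteqP; split=> w //= [-> m00]; rewrite m00 in m0.
    transitivity ((group_law m alpha m)%:E + (group_law m alpha 0)%:E)%E.
      by congr adde; exact: pm_eta_law.
    rewrite /group_law eqxx ltn_eqF // eqxx -EFinD.
    by congr EFin; ring.
  - move=> w /= + [etam|eta0]; apply.
      by rewrite /group_at etam eqxx mul1n.
    by rewrite /group_at eta0 eq_sym gtn_eqF.
(* The vertices are countable: [pickle] numbers them, and a number coding no vertex carries no
   condition. *)
pose Q (n : nat) (w : pm_space M) :=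
  if @unpickle (seq 'I_d) n is Some v then pm_eta M v w = (group_at w v * m)%N
  else True.
have : {ae pm_prob M, forall w, forall n, Q n w}.
  apply: (ae_foralln (P := Q)) => n; rewrite /Q.
  by case: (unpickle n) => [v|]; [exact: (H v) | exact: aeW].
apply: filterS => w wH v.
by have := wH (pickle (v : seq 'I_d)); rewrite /Q pickleK.
Qed.

Definition root_arrivals (n : nat) (w : pm_space M) : nat :=
  arrivals_before (fun v => pm_eta M v w) (fun v k => pm_choice M v k w) n
    (root_vertex d).

Lemma root_totalE w :
  root_total w = (limn (fun n => (root_arrivals n w)%:R%:E))%E.
Proof.
rewrite /root_total /total_arrivals; congr (limn _); apply/funext => n.
by rewrite sumEFin -natr_sum big_mkord.
Qed.

Lemma cvg_root_arrivals w :
  (fun n => (root_arrivals n w)%:R%:E : \bar R)%E @ \oo --> root_total w.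
Proof.
rewrite root_totalE; apply: ereal_nondecreasing_is_cvgn => a b ab.
have E n : root_arrivals n w = (\sum_(0 <= s < n) size (arrivals_at
    (fun v => pm_eta M v w) (fun v k => pm_choice M v k w) s (root_vertex d)))%N.
  by rewrite big_mkord.
by rewrite lee_fin ler_nat !E (big_cat_nat (leq0n a) ab) leq_addr.
Qed.

Lemma root_arrivals_le w n : ((root_arrivals n w)%:R%:E <= root_total w)%E.
Proof.
rewrite /root_total /total_arrivals.
apply: le_trans (nneseries_lim_ge n _); last by move=> k _ _; rewrite lee_fin.
by rewrite sumEFin -natr_sum big_mkord.
Qed.

End Model.

(** * Descendants in the tree *)

Section Subtrees.
Context (d : nat).
Implicit Types v u : vertex d.

Definition subtree v : pred (vertex d) := fun u => suffix v u.

Definition strict_subtree v : pred (vertex d) :=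
  fun u => suffix v u && (size v < size u)%N.

Lemma subtree_cons i v u : subtree (i :: v) u -> strict_subtree v u.
Proof.
move=> /suffixP[s ->]; rewrite /strict_subtree size_cat /=; apply/andP; split.
  by apply/suffixP; exists (rcons s i); rewrite cat_rcons.
by rewrite addnS ltnS leq_addl.
Qed.

Lemma strict_subtreeW v u : strict_subtree v u -> subtree v u.
Proof. by case/andP. Qed.

Lemma subtree_children_disjoint i j v u :
  subtree (i :: v) u -> subtree (j :: v) u -> i = j.
Proof.
move=> /suffixP[s ->] /suffixP[t st].
have sz : size s = size t by have := congr1 size st; rewrite !size_cat /=; lia.
by move/eqP: st; rewrite eqseq_cat // => /andP[_ /eqP[]].
Qed.

End Subtrees.

(** * Surplus cars from overlapping jumps of triples *)

Section Overlap.
Context (R : realType) (d : nat) (i0 i1 : 'I_d).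
Hypothesis i01 : i0 != i1.
Implicit Types (v u : vertex d) (x : vertex d -> bool).

(* The pairs of triples at i0 :: j :: i :: u and i1 :: j :: i :: u, where u is a
   triple reached from v by fewer than n jumps of three generations between
   triples. *)
Fixpoint overlap (n : nat) v x : nat :=
  if n is n'.+1 then
    x v * \sum_(i < d) \sum_(j < d)
      (x (i0 :: j :: i :: v) * x (i1 :: j :: i :: v)
       + \sum_(k < d) overlap n' (k :: j :: i :: v) x)
  else 0.

(** A generation has [d^2] choices of [i] and [j], each needing three triples, hence [p^3 d^2]. The
    factor [p d^3 = 1] passes on the mean of later generations unchanged. *)
Lemma overlap_mean (p : R) n v : p * d%:R ^+ 3 = 1 ->
  multilinear_mean p (subtree v) (fun x => (overlap n v x)%:R)
    (n%:R * (p ^+ 3 * d%:R ^+ 2)).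
Proof.
move=> pd; elim: n v => [|n IH] v.
  by apply: (multilinear_mean_ext _ _ (multilinear_mean_cst _ _ 0)) => //=;
     rewrite mul0r.
have IHijk i j k : multilinear_mean p (strict_subtree v)
    (fun x => (overlap n (k :: j :: i :: v) x)%:R) (n%:R * (p ^+ 3 * d%:R ^+ 2)).
  apply: multilinear_mean_sub (IH _) => u.
  by do 2![move=> /subtree_cons /strict_subtreeW]; apply: subtree_cons.
have pair i j : multilinear_mean p (strict_subtree v)
    (fun x => (x (i0 :: j :: i :: v))%:R * (x (i1 :: j :: i :: v))%:R) (p * p).
  have one k : multilinear_mean p (pred1 (k :: j :: i :: v))
      (fun x => (x (k :: j :: i :: v))%:R) p.
    by apply: multilinear_mean_var => /=.
  apply: multilinear_mean_sub (multilinear_meanM _ (one i0) (one i1)).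
    move=> u /orP[] /eqP ->;
    by do 2![apply/subtree_cons/strict_subtreeW];
       apply/subtree_cons/suffix_refl.
  by move=> u /eqP-> /eqP[ii]; move: i01; rewrite ii eqxx.
have below := multilinear_mean_sum (index_enum 'I_d) (fun i =>
  multilinear_mean_sum (index_enum 'I_d) (fun j =>
    multilinear_meanD (pair i j)
      (multilinear_mean_sum (index_enum 'I_d) (IHijk i j)))).
have root : multilinear_mean p (pred1 v) (fun x => (x v)%:R) p.
  by apply: multilinear_mean_var => /=.
have disj u : pred1 v u -> strict_subtree v u -> False.
  by move=> /eqP -> /andP[_]; rewrite ltnn.
apply: multilinear_mean_sub
  (multilinear_mean_ext _ _ (multilinear_meanM disj root below)).
- by move=> u /orP[/eqP ->|/strict_subtreeW //]; apply: suffix_refl.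
- move=> x /=; rewrite natrM natr_sum; congr (_ * _); apply: eq_bigr => i _.
  rewrite natr_sum; apply: eq_bigr => j _.
  by rewrite natrD natrM natr_sum.
- have sumE (c : R) : \sum_(i < d) c = d%:R * c.
    by rewrite sumr_const card_ord mulr_natl.
  rewrite !sumE -natr1.
  transitivity (p ^+ 3 * d%:R ^+ 2
                + p * d%:R ^+ 3 * (n%:R * (p ^+ 3 * d%:R ^+ 2))); first by ring.
  by rewrite pd; ring.
Qed.

(** The term [3 * x v] carries the induction: it pays for the spot of [v] and the next two. A jump
    takes three time steps; the extra one counts the initial cars. *)
Lemma overlap_le_arrivals eta choice x n v :
  (forall u, 3 * x u <= eta u)%N ->
  (3 * x v + overlap n v x <= arrivals_before eta choice (3 * n).+1 v)%N.
Proof.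
move=> xeta; elim: n v => [|n IH] v.
  by rewrite addn0 muln0 arrivals_beforeS (leq_trans (xeta v)) // leq_addr.
rewrite mulnS !addSn add0n arrivals_beforeS /=.
have := xeta v; case: (x v) => /=; last by rewrite mul0n.
rewrite mul1n muln1 => eta3; apply: leq_add => //.
apply: leq_sum => i _; rewrite arrivals_beforeS.
set a := arrivals_before eta choice.
pose N j := (\sum_(k < d) x (k :: j :: i :: v))%N.
pose E j := (x (i0 :: j :: i :: v) * x (i1 :: j :: i :: v)
   + \sum_(k < d) overlap n (k :: j :: i :: v) x)%N.
have overlap0 u : x u = false -> overlap n u x = 0%N.
  by case: (n) => //= n' ->.
have E0 j : N j = 0%N -> E j = 0%N.
  move=> /eqP; rewrite sum_nat_eq0 => /forallP/= x0.
  have {}x0 k : x (k :: j :: i :: v) = false.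
    by have := x0 k; case: (x _).
  by rewrite /E x0 big1 // => k _; apply: overlap0.
(* The triples above send at least [2 * N j] cars to [j :: i :: v], where one parks. With [N j] set
   aside for the next spot, [N j - 1] remain, at least one if [i0] and [i1] both give triples. *)
have aE j : (N j + E j <= (a (3 * n).+2 (j :: i :: v)).-1)%N.
  have [N0|N0] := posnP (N j); first by rewrite N0 E0.
  have : (2 * N j + \sum_(k < d) overlap n (k :: j :: i :: v) x
      <= a (3 * n).+2 (j :: i :: v))%N.
    rewrite /a arrivals_beforeS /N big_distrr -big_split /=.
    apply: leq_trans (leq_addl _ _); apply: leq_sum => k _.
    have := IH (k :: j :: i :: v); rewrite -/a.
    have := overlap0 (k :: j :: i :: v); case: (x _) => [_|->]//; lia.
  have : (x (i0 :: j :: i :: v) + x (i1 :: j :: i :: v) <= N j)%N.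
    by rewrite /N (bigD1 i0) //= leq_add2l (bigD1 i1) 1?eq_sym //= leq_addr.
  by rewrite /E; case: (x (i0 :: _)); case: (x (i1 :: _)) => /=; lia.
have NEa : (\sum_j N j + \sum_j E j <=
    \sum_j (a (3 * n).+2 (j :: i :: v)).-1)%N.
  by rewrite -big_split; apply: leq_sum => j _; apply: aE.
(* The spot of [i :: v] takes one car, paid from the sum of the [N j]; if that sum is zero, so are
   all [E j]. *)
have leq_pred (k e s t : nat) :
    (k + e <= s)%N -> (k = 0 -> e = 0)%N -> (e <= (t + s).-1)%N by lia.
apply: leq_pred NEa _.
move=> /eqP; rewrite sum_nat_eq0 => /forallP/= NN0.
by apply: big1 => j _; apply: E0; apply/eqP; apply: NN0.
Qed.

End Overlap.

(** * An exponential majorant for pairs *)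

Section Envelope.
Context (R : realType) (d : nat) (z : R).
Implicit Types (v u : vertex d) (x : vertex d -> bool).

(** A majorant of [z^(S_n(v))] for [z >= 1]. The first factor is [z^(2 x v)], the others bound
    [z^((S-1)^+)] at the children; all are written in affine form to keep every vertex at degree
    one. *)
Fixpoint envelope (n : nat) v x : R :=
  if n is n'.+1 then
    (1 + (z ^+ 2 - 1) * (x v)%:R) *
    \prod_(i < d) (1 + (envelope n' (i :: v) x - 1) / z)
  else 1.

Fixpoint envelope_value (p : R) (n : nat) : R :=
  if n is n'.+1 then
    (1 + (z ^+ 2 - 1) * p) * (1 + (envelope_value p n' - 1) / z) ^+ d
  else 1.

Lemma envelope_mean p n v :
  multilinear_mean p (subtree v) (envelope n v) (envelope_value p n).
Proof.
elim: n v => [|n IH] v; first exact: multilinear_mean_cst.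
have cst (D : pred (vertex d)) c := multilinear_mean_cst p D c.
have root : multilinear_mean p (pred1 v)
    (fun x => 1 + (z ^+ 2 - 1) * (x v)%:R) (1 + (z ^+ 2 - 1) * p).
  have one : multilinear_mean p (pred1 v) (fun x => (x v)%:R) p.
    by apply: multilinear_mean_var => /=.
  exact: multilinear_meanD (cst _ 1) (multilinear_meanZ (z ^+ 2 - 1) one).
have child i : multilinear_mean p (subtree (i :: v))
    (fun x => 1 + (envelope n (i :: v) x - 1) / z)
    (1 + (envelope_value p n - 1) / z).
  have := multilinear_meanD (cst _ 1) (multilinear_meanZ z^-1
    (multilinear_meanD (IH (i :: v)) (cst _ (-1)))).
  by apply: multilinear_mean_ext => [x|]; rewrite [_ / z]mulrC.
have children := multilinear_mean_prod (index_enum_uniq 'I_d)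
  (fun i j u => @subtree_children_disjoint _ i j v u) child.
have below u : has ((fun i => subtree (i :: v))^~ u) (index_enum 'I_d) ->
    strict_subtree v u.
  by case/hasP => i _; apply: subtree_cons.
have disj u : pred1 v u ->
    has ((fun i => subtree (i :: v))^~ u) (index_enum 'I_d) -> False.
  by move=> /eqP -> /below /andP[_]; rewrite ltnn.
apply: multilinear_mean_sub
  (multilinear_mean_ext _ _ (multilinear_meanM disj root children)).
- move=> u /orP[/eqP ->|/below/strict_subtreeW //]; exact: suffix_refl.
- by [].
- by rewrite prodr_const card_ord.
Qed.

Lemma envelope_ge1 n v x : 1 <= z -> 1 <= envelope n v x.
Proof.
move=> z1; elim: n v => //= n IH v.
have z2 : 0 <= z ^+ 2 - 1 by rewrite subr_ge0 exprn_ege1.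
have ge1M (a b : R) : 1 <= a -> 1 <= b -> 1 <= a * b.
  by move=> a1 b1; rewrite -[leLHS]mulr1 ler_pM.
apply: (ge1M); first by rewrite lerDl mulr_ge0.
apply: (big_ind (fun y : R => 1 <= y)) => // i _.
by rewrite lerDl divr_ge0 ?subr_ge0 // (le_trans _ z1).
Qed.

Lemma expr_arrivals_le eta choice x n v : 1 <= z ->
  (forall u, eta u = x u * 2)%N ->
  z ^+ arrivals_before eta choice n v <= envelope n v x.
Proof.
move=> z1 etax; have z0 : 0 < z by apply: lt_le_trans z1.
elim: n v => [|n IH] v; first by rewrite /arrivals_before big_ord0.
rewrite arrivals_beforeS exprD -prodrXr etax /=.
apply: ler_pM; [by rewrite exprn_ge0 // ltW|
  by rewrite prodr_ge0 // => i _; rewrite exprn_ge0 // ltW| |].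
  by case: (x v) => /=; rewrite ?mulr0 ?mulr1; lra.
apply: ler_prod => i _; rewrite exprn_ge0 1?(ltW z0) //=.
(* Without arrivals the left side is 1; otherwise it is [z^S / z], and [1 - 1/z >= 0] closes the
   gap. *)
have := IH (i :: v); case: arrivals_before => [|k] /= zE.
  by rewrite expr0 lerDl divr_ge0 1?(ltW z0) // subr_ge0.
have zk : z ^+ k <= envelope n (i :: v) x / z by rewrite ler_pdivlMr // -exprSr.
by rewrite mulrBl mul1r addrA; have : z^-1 <= 1 by [rewrite invf_le1]; lra.
Qed.

End Envelope.

(** A product form of [(1 + t)^n <= 1 / (1 - n t)], meaningful for all [t >= 0]. *)
Lemma bernoulli_inv (R : realType) (t : R) n :
  0 <= t -> (1 + t) ^+ n * (1 - n%:R * t) <= 1.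
Proof.
move=> t0; elim: n => [|n IH]; first by rewrite expr0 mul0r; lra.
apply: le_trans IH; rewrite exprSr -mulrA; apply: ler_wpM2l.
  by apply: exprn_ge0; lra.
have := ler0n R n; rewrite -natr1; nra.
Qed.

(** If the previous value is at most 2, then [t <= 1 / (4 d)] and [(1 + t)^d <= 4/3]. Moreover
    [z^2 p = 32 / d <= 1/2] for [d >= 64], and [3/2] times [4/3] is 2. *)
Lemma envelope_value_le2 (R : realType) (d n : nat) : (64 <= d)%N ->
  let e := @envelope_value R d (4%:R * d%:R) (2%:R / d%:R ^+ 3) n in 1 <= e <= 2%:R.
Proof.
move=> d64 /=; have D64 : 64%:R <= d%:R :> R by rewrite ler_nat.
set D : R := d%:R in D64 *; have D0 : 0 < D by lra.
elim: n => [|n /andP[e1 e2]] /=; first by lra.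
set t := (_ - 1) / _.
have t0 : 0 <= t by apply: divr_ge0; lra.
have Dt : d%:R * t <= 1 / 4%:R.
  rewrite /t -/D mulrA ler_pdivrMr; nra.
have := bernoulli_inv d t0.
have : 1 <= (1 + t) ^+ d by apply: exprn_ege1; lra.
set y := (1 + t) ^+ d => y1 yb.
have pE : ((4%:R * D) ^+ 2 - 1) * (2%:R / D ^+ 3) = 32%:R / D - 2%:R / D ^+ 3.
  by field; rewrite gt_eqF.
have p0 : 0 < 2%:R / D ^+ 3 by rewrite divr_gt0 // exprn_gt0.
have r2 : 32%:R / D <= 1 / 2%:R by rewrite ler_pdivrMr; lra.
have w0 : 0 <= ((4%:R * D) ^+ 2 - 1) * (2%:R / D ^+ 3).
  by apply: mulr_ge0; [nra|lra].
set w := _ * (2%:R / _) in pE w0 *.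
by apply/andP; split; nra.
Qed.

(** * Infinite mean for triples, no almost sure explosion for pairs *)

Lemma integral_root_total_triples (R : realType) (d : nat)
    (M : parking_model d (group_law 3 (3%:R * d%:R ^- 3 : R))) :
  (2 <= d)%N -> (\int[pm_prob M]_w root_total w = +oo)%E.
Proof.
move=> d2; have D0 : 0 < d%:R :> R by rewrite ltr0n; lia.
set p : R := 3%:R * d%:R ^- 3 / 3%:R.
have pE : p = d%:R ^- 3 by rewrite /p; field; rewrite gt_eqF.
have pd : p * d%:R ^+ 3 = 1 by rewrite pE mulVf // gt_eqF // exprn_gt0.
have i01 : Ordinal (ltnW d2) != Ordinal d2 by [].
have ge_mean n : ((n%:R * (p ^+ 3 * d%:R ^+ 2))%:E
    <= \int[pm_prob M]_w root_total w)%E.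
  have [_ <-] := integral_multilinear_mean M
    (overlap_mean i01 n (root_vertex d) pd).
  apply: ge0_le_integral_nonmeasurable => w; first by rewrite lee_fin.
  apply: le_trans (root_arrivals_le w (3 * n).+1); rewrite lee_fin ler_nat.
  have := overlap_le_arrivals i01 (fun v k => pm_choice M v k w) (x := group_at w)
    (eta := fun v => pm_eta M v w) n (root_vertex d).
  move=> /(_ _) H; apply: leq_trans (H _); first exact: leq_addl.
  by move=> u; rewrite /group_at; case: eqP => [->|].
apply/eqyP => A A0; set c := p ^+ 3 * d%:R ^+ 2 in ge_mean.
have c0 : 0 < c by rewrite /c pE mulr_gt0 ?exprn_gt0 ?invr_gt0 ?exprn_gt0.
(* More than [A / c] generations push the mean above [A]. *)
apply: le_trans (ge_mean (Num.truncn (A / c)).+1).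
by rewrite lee_fin -ler_pdivrMr // ltW // truncnS_gt.
Qed.

(** By Fatou's lemma: off a null set the lower limit would be infinite, and so would its integral,
    while the integrals stay below [c]. *)
Lemma not_ae_cvgey (disp : measure_display) (T : measurableType disp)
    (R : realType) (P : probability T R) (F : nat -> T -> \bar R) (c : R) :
  (forall n, measurable_fun setT (F n)) -> (forall n w, 0 <= F n w)%E ->
  (forall n, \int[P]_w F n w <= c%:E)%E ->
  ~ {ae P, forall w, F n w @[n --> \oo] --> +oo%E}.
Proof.
move=> mF F0 Fc [N [mN PN Fy]].
have mD : measurable (~` N) by apply: measurableC.
have mFD n : measurable_fun (~` N) (F n) by apply: measurable_funTS.
have := fatou P mD mFD (fun n w _ => F0 n w).
have -> : (\int[P]_(w in ~` N) limn_einf (F^~ w) = +oo)%E.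
  transitivity (\int[P]_(w in ~` N) cst +oo w)%E.
    apply: eq_integral => w /[!inE] wN.
    have {}Fy : F n w @[n --> \oo] --> +oo%E.
      by apply/not_notP => nFy; apply: wN; apply: Fy.
    by rewrite is_cvg_limn_einfE ?(cvg_lim _ Fy) //; apply/cvg_ex; exists +oo%E.
  transitivity (+oo * P (~` N))%E; first exact: integral_cst.
  have -> : P (~` N) = 1%E; last exact: mule1.
  by rewrite probability_setC // -[RHS]sube0; congr (_ - _)%E.
rewrite limn_einf_lim leye_eq => /eqP limy.
have : (limn (einfs (fun n => \int[P]_(w in ~` N) F n w)) <= c%:E)%E.
  apply: lime_le; first exact: is_cvg_einfs.
  apply: nearW => n; apply: (@le_trans _ _ (\int[P]_(w in ~` N) F n w)%E).
    by apply: ereal_inf_lbound; exists n => /=.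
  by apply: le_trans (Fc n); apply: ge0_subset_integral.
by rewrite limy leye_eq.
Qed.

Lemma not_ae_root_total_pairs (R : realType) (d : nat)
    (M : parking_model d (group_law 2 (4%:R * d%:R ^- 3 : R))) :
  (64 <= d)%N -> ~ {ae pm_prob M, forall w, root_total w = +oo%E}.
Proof.
move=> d64 aey; have D64 : 64%:R <= d%:R :> R by rewrite ler_nat.
have pE : 4%:R * d%:R ^- 3 / 2%:R = 2%:R / d%:R ^+ 3 :> R.
  by field; rewrite gt_eqF //; lra.
pose z : R := 4%:R * d%:R; have z2 : 2%:R <= z by rewrite /z; lra.
have z1 : 1 <= z by lra.
have Fint n := integral_multilinear_mean M
  (envelope_mean z (4%:R * d%:R ^- 3 / 2%:R) n (root_vertex d)).
apply: (@not_ae_cvgey _ _ _ (pm_prob M)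
  (fun n w => (envelope z n (root_vertex d) (group_at w))%:E) 2%:R).
- by move=> n; have [/measurable_int] := Fint n.
- by move=> n w; rewrite lee_fin (le_trans ler01) // envelope_ge1.
- move=> n; have [_ ->] := Fint n; rewrite lee_fin pE.
  by have /andP[] := envelope_value_le2 R n d64.
(* Since [z >= 2], the envelopes dominate the arrivals themselves and diverge wherever these do. *)
have le_expz n : n%:R <= z ^+ n.
  apply: le_trans (_ : 2%:R ^+ n <= _); last by apply: lerXn2r; rewrite ?nnegrE; lra.
  by rewrite -natrX ler_nat ltnW // ltn_expl.
apply: filterS2 aey (ae_pm_eta M isT) => w wy weta.
have := @cvg_root_arrivals _ _ _ _ _ w; rewrite wy => /cvgeyPge ay; apply/cvgeyPge => A.
apply: filterS (ay A) => n /le_trans; apply; rewrite lee_fin.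
exact: le_trans (le_expz _) (expr_arrivals_le _ _ _ z1 weta).
Qed.

(** * Comparison of the thresholds *)

Theorem proposition6 (R : realType)
    (M3 : forall (d : nat) (alpha : R), 0 <= alpha <= 3%:R ->
          parking_model d (group_law 3 alpha))
    (M2 : forall (d : nat) (alpha : R), 0 <= alpha <= 2%:R ->
          parking_model d (group_law 2 alpha))
    (alpha_c' alpha_c : nat -> R)
    (Halpha_c' : forall d : nat, (2 <= d)%N ->
          is_critical_threshold (M3 d) (alpha_c' d))
    (Halpha_c : forall d : nat, (2 <= d)%N ->
          is_critical_threshold (M2 d) (alpha_c d)) :
  (forall d : nat, (2 <= d)%N -> alpha_c' d <= 3%:R * d%:R ^- 3) /\
  (exists N : nat, forall d : nat, (2 <= d)%N -> (N <= d)%N ->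
     alpha_c' d < alpha_c d).
Proof.
(* The bound [1/2] puts [3 d^-3] in [[0, 3]] and [4 d^-3] in [[0, 2]], the ranges of the two
   families. *)
have V3 d : (2 <= d)%N -> 0 < (d%:R : R) ^- 3 <= 2%:R^-1.
  move=> d2; have D2 : 2%:R <= d%:R :> R by rewrite ler_nat.
  have d30 : 0 < d%:R ^+ 3 :> R by rewrite exprn_gt0 //; lra.
  rewrite invr_gt0 d30 lef_pV2 ?posrE //=.
  apply: (le_trans D2); apply: ler_eXnr => //; lra.
have ub d : (2 <= d)%N -> alpha_c' d <= 3%:R * d%:R ^- 3.
  move=> d2; rewrite leNgt; apply/negP => lt_ac.
  have h : 0 <= 3%:R * (d%:R : R) ^- 3 <= (3%:R : R).
    by have /andP[V0 V2] := V3 d d2; apply/andP; split; lra.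
  have [_ /(_ _ h)[/(_ lt_ac) + _]] := Halpha_c' d d2.
  by rewrite integral_root_total_triples.
(* If [alpha_c d <= alpha_c' d], then [alpha_c d <= 3 d^-3 < 4 d^-3], so pairs would explode almost
   surely at [4 d^-3]. *)
split=> //; exists 64%N => d d2 d64; rewrite ltNge; apply/negP => le_ac.
have /andP[V0 V2] := V3 d d2.
have h : 0 <= 4%:R * (d%:R : R) ^- 3 <= (2%:R : R) by apply/andP; split; lra.
have [_ /(_ _ h)[_]] := Halpha_c d d2.
have lt_ac : alpha_c d < 4%:R * d%:R ^- 3 by have := ub d d2; lra.
by move=> /(_ lt_ac); apply: not_ae_root_total_pairs.
Qed.
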